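(* Let $A,B\in\mathbb{C}^{m\times n}$ and $B_1,\tilde W\in\mathbb{C}^{n\times m}$ with $(A\tilde W)(B\tilde W)=(B\tilde W)(A\tilde W)$ and $\tilde k=\max\{\mathrm{ind}(A\tilde W),\mathrm{ind}(B\tilde W),\mathrm{ind}(A\tilde W B\tilde W)\}$. Suppose $X_2$, $Y_3$ and $Z_2$ are the minimal rank $W$-weighted weak Drazin inverses of $A\tilde W B$, $B$ and $A$, respectively, with $(Y_3\tilde W)(A\tilde W)=(A\tilde W)(Y_3\tilde W)$. If $\mathcal Y$ is a $W$-weighted weak MPD inverse of $A\tilde W B$, then the general solution of the equation $$\mathcal Y(A\tilde W B\tilde W)^{\tilde k+1}=B_1(A\tilde W B\tilde W)^{\tilde k}$$ is given by $$\mathcal Y=B_1X_2\tilde W+Z(I-A\tilde W B\tilde W X_2\tilde W),$$ where $Z\in\mathbb{C}^{n\times m}$ is any arbitrary matrix.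
   Context: $^{\dagger}$ denotes the Moore-Penrose inverse and $I$ the identity matrix. For a square complex matrix $T$, $\mathrm{ind}(T)$ is the smallest nonnegative integer $k$ with $\mathrm{rank}(T^k)=\mathrm{rank}(T^{k+1})$ (with $T^0=I$). For $C\in\mathbb{C}^{m\times n}$ and $k=\mathrm{ind}(C\tilde W)$, a matrix $X\in\mathbb{C}^{m\times n}$ is a minimal rank $W$-weighted weak Drazin inverse of $C$ (with respect to the weight $\tilde W$) if $X\tilde W(C\tilde W)^{k+1}=(C\tilde W)^{k}$ and $\mathrm{rank}(X)=\mathrm{rank}((C\tilde W)^{k})$. A $W$-weighted weak MPD inverse of $C$ is a matrix $C^{\dagger}C\tilde W X\tilde W\in\mathbb{C}^{n\times m}$, where $X$ is a fixed minimal rank $W$-weighted weak Drazin inverse of $C$. *)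

(* Defs.v *)
From mathcomp Require Import all_boot all_order all_algebra.
From mathcomp Require Import classical_sets reals.
From mathcomp Require Export complex.

Set Implicit Arguments.
Unset Strict Implicit.
Unset Printing Implicit Defensive.

Import Order.TTheory GRing.Theory Num.Theory.
Local Open Scope ring_scope.
Local Open Scope sesquilinear_scope.

Section Index.
Context {F : fieldType} {m : nat}.
Implicit Type T : 'M[F]_m.

Lemma mxind_subproof T : exists k, \rank (T ^+ k) == \rank (T ^+ k.+1).
Proof.
suff [k kP] : exists k : 'I_m.+1, \rank (T ^+ k) == \rank (T ^+ k.+1).
  by exists k.
apply/existsP; rewrite -[X in is_true X]negbK negb_exists; apply/negP.
move=> /forallP nT.
suff H k : (k <= m.+1)%N -> (\rank (T ^+ k) + k <= m)%N.
  by have := H _ (leqnn _); rewrite leqNgt addnS ltnS leq_addl.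
elim: k => [|k IH] km; first by rewrite addn0 rank_leq_row.
apply: leq_trans (IH (ltnW km)); rewrite addnS ltn_add2r ltn_neqAle.
by rewrite eq_sym (nT (Ordinal km)) /= exprS mxrankM_maxr.
Qed.

Definition mxind T : nat := ex_minn (mxind_subproof T).

End Index.

Section MoorePenrose.
Context {C : numClosedFieldType}.

Definition penrose m n (A : 'M[C]_(m, n)) (G : 'M[C]_(n, m)) : Prop :=
  [/\ A *m G *m A = A, G *m A *m G = G,
      (A *m G) ^t* = A *m G & (G *m A) ^t* = G *m A].

Definition mpinv m n (A : 'M[C]_(m, n)) : 'M[C]_(n, m) :=
  xget 0 [set G | penrose A G]%classic.

Lemma adjmxM m n p (A : 'M[C]_(m, n)) (B : 'M[C]_(n, p)) :
  (A *m B) ^t* = B ^t* *m A ^t*.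
Proof. by rewrite trmx_mul map_mxM. Qed.

Lemma gram_unitmx m n (G : 'M[C]_(m, n)) :
  row_free G -> G *m G ^t* \in unitmx.
Proof.
move=> Gfree; rewrite -row_free_unit -kermx_eq0; apply/rowV0P => u.
move=> /sub_kermxP uGG; apply: (row_free_inj Gfree).
rewrite mul0mx; apply/eqP/negPn/negP => /dotmx_is_dotmx.
by rewrite dotmxE adjmxM mulmxA -(mulmxA u) uGG mul0mx mxE ltxx.
Qed.

Lemma penrose_exists m n (A : 'M[C]_(m, n)) : exists G, penrose A G.
Proof.
have := mulmx_base A; have := row_base_free A; have := col_base_full A.
move: (\rank A) (col_base A) (row_base A) => r P Q Pfull Qfree AE.
have QU : Q *m Q ^t* \in unitmx by apply: gram_unitmx.
have PU : P ^t* *m P \in unitmx.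
  rewrite -[X in _ *m X]trmxCK; apply: gram_unitmx.
  by rewrite /row_free mxrank_map mxrank_tr.
pose q := invmx (Q *m Q ^t*); pose p := invmx (P ^t* *m P).
have Qq : Q *m Q ^t* *m q = 1%:M by rewrite mulmxV.
have pP : p *m (P ^t* *m P) = 1%:M by rewrite mulVmx.
have qH : q ^t* = q.
  by rewrite /q trmx_inv map_invmx adjmxM trmxCK.
have pH : p ^t* = p.
  by rewrite /p trmx_inv map_invmx adjmxM trmxCK.
exists (Q ^t* *m q *m p *m P ^t*).
have AG : A *m (Q ^t* *m q *m p *m P ^t*) = P *m p *m P ^t*.
  by rewrite -AE !mulmxA -(mulmxA P Q) -(mulmxA P _ q) Qq mulmx1.
have GA : Q ^t* *m q *m p *m P ^t* *m A = Q ^t* *m q *m Q.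
  by rewrite -AE !mulmxA -(mulmxA _ _ P) -(mulmxA _ p) pP mulmx1.
split.
- rewrite AG -AE -!mulmxA (mulmxA (P ^t*)) (mulmxA p).
  by rewrite pP mul1mx.
- rewrite GA -!mulmxA (mulmxA Q) (mulmxA (Q *m _)).
  by rewrite Qq mul1mx.
- by rewrite AG !adjmxM trmxCK pH mulmxA.
- by rewrite GA !adjmxM trmxCK qH mulmxA.
Qed.

Lemma penrose_unique m n (A : 'M[C]_(m, n)) G H :
  penrose A G -> penrose A H -> G = H.
Proof.
move=> [g1 g2 g3 g4] [h1 h2 h3 h4].
have AGH : A *m G = A *m H.
  by rewrite -g3 -{1}h1 -mulmxA adjmxM g3 h3 mulmxA g1.
have GHA : G *m A = H *m A.
  by rewrite -g4 -{1}h1 !mulmxA -(mulmxA _ H) adjmxM g4 h4 -mulmxA (mulmxA A) g1.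
by rewrite -g2 GHA -mulmxA AGH mulmxA h2.
Qed.

Lemma mpinvP m n (A : 'M[C]_(m, n)) : penrose A (mpinv A).
Proof. exact: xgetPex (penrose_exists A). Qed.

End MoorePenrose.

Section WeightedWeak.
Context {K : numClosedFieldType} {m n : nat}.
Implicit Types (C X : 'M[K]_(m, n)) (W Y : 'M[K]_(n, m)).

Definition min_rank_weak_drazin W C X : Prop :=
  let k := mxind (C *m W) in
  X *m W *m (C *m W) ^+ k.+1 = (C *m W) ^+ k /\
  \rank X = \rank ((C *m W) ^+ k).

(* Minimal rank weighted weak Drazin inverses are not unique in general, so
   neither are weak MPD inverses: there is one for each choice of X. *)
Definition weak_mpd W C Y : Prop :=
  exists2 X, min_rank_weak_drazin W C X &
    Y = mpinv C *m C *m W *m X *m W.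

End WeightedWeak.

(* Main.v *)
(* Put T = AWBW, j = ind T and X = X2 W.  From X T^(j+1) = T^j one gets
   X^i T^(j+i) = T^j, so rank T^k = rank T^j for k >= j; together with
   rank X2 = rank T^j this forces X = T^k E for some E.  A solution U then
   satisfies U T X = U T^(k+1) E = B1 T^k E = B1 X, so it has the required form
   with Z = U. *)
Require Import Defs.
From mathcomp Require Import all_boot all_order all_algebra reals.
Import GRing.Theory.
Local Open Scope ring_scope.

Section RankAndSolutions.
Set Implicit Arguments.
Unset Strict Implicit.
Context {F : fieldType}.

(** The column space of [M *m N] lies in that of [M], and equal ranks make the two coincide.
    Transposes turn column spaces into the row spaces that [submx] compares. *)
Lemma mulmx_rank_right_factor p q r (M : 'M[F]_(p, q)) (N : 'M[F]_(q, r)) :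
  \rank (M *m N) = \rank M -> exists E : 'M[F]_(r, q), M = M *m N *m E.
Proof.
move=> rMN; have sMN : ((M *m N)^T <= M^T)%MS by rewrite trmx_mul submxMl.
have : (M^T <= (M *m N)^T)%MS.
  by rewrite -(geq_leqif (mxrank_leqif_sup sMN)) !mxrank_tr rMN.
by move=> /submxP[D /(congr1 trmx)]; rewrite trmx_mul !trmxK; exists D^T.
Qed.

(** Splitting off [T ^+ j.+1] on the left, next to the innermost [X], cancels one factor [T] for
    each factor [X]. *)
Lemma weak_inverse_exp m (T X : 'M[F]_m) j i :
  X *m T ^+ j.+1 = T ^+ j -> X ^+ i *m T ^+ (i + j) = T ^+ j.
Proof.
move=> XT; elim: i => [|i IHi]; first by rewrite expr0 mul1mx.
rewrite exprSr -mulmxE -mulmxA addSnnS addnC exprD -mulmxE (mulmxA X) XT.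
by rewrite mulmxE -exprD addnC.
Qed.

Lemma min_rank_weak_inverse_factor m n (T : 'M[F]_m) (X : 'M[F]_(m, n))
    (W : 'M[F]_(n, m)) j k :
  X *m W *m T ^+ j.+1 = T ^+ j -> \rank X = \rank (T ^+ j) -> (j <= k)%N ->
  exists E : 'M[F]_(m, n), X = T ^+ k *m E.
Proof.
move=> XWT rX le_jk.
have [|E XE] := @mulmx_rank_right_factor _ _ _ X (W *m T ^+ j.+1).
  by rewrite mulmxA XWT rX.
have TjE : T ^+ j *m T ^+ (k - j) = T ^+ k by rewrite mulmxE -exprD subnKC.
have [|D TjD] := @mulmx_rank_right_factor _ _ _ (T ^+ j) (T ^+ (k - j)).
  apply/eqP; rewrite eqn_leq mxrankM_maxl TjE.
  (* Lower bound on the rank: [T ^+ j] is a left multiple of [T ^+ k], by [(X *m W) ^+ (k - j)]. *)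
  by rewrite -{1}(weak_inverse_exp (k - j) XWT) subnK // mxrankM_maxr.
by exists (D *m E); rewrite mulmxA -TjE -TjD -XWT -(mulmxA X).
Qed.

Lemma weak_inverse_equation_solutions m n p (T : 'M[F]_m) (X : 'M[F]_(m, n))
    (W : 'M[F]_(n, m)) (B U : 'M[F]_(p, m)) j k :
  X *m W *m T ^+ j.+1 = T ^+ j -> \rank X = \rank (T ^+ j) -> (j <= k)%N ->
  U *m T ^+ k.+1 = B *m T ^+ k <->
  exists Z : 'M[F]_(p, m), U = B *m X *m W + Z *m (1%:M - T *m X *m W).
Proof.
move=> XWT rX le_jk; split=> [UT | [Z ->]].
  have [E XE] := min_rank_weak_inverse_factor XWT rX le_jk.
  have UTX : U *m T *m X = B *m X.
    by rewrite XE !mulmxA -UT exprS -mulmxE mulmxA.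
  (* [U] splits as [U *m T *m X *m W] plus [U] times the remaining factor. *)
  by exists U; rewrite mulmxBr mulmx1 !mulmxA UTX addrC subrK.
(* Converse: the hypothesis lifts from [j] to [k], so [T *m X *m W] fixes [T ^+ k.+1] and the term
   in [Z] vanishes. *)
have XTk : X *m W *m T ^+ k.+1 = T ^+ k.
  by rewrite -(subnKC le_jk) -addSn !exprD -!mulmxE mulmxA XWT.
have TXTk : T *m X *m W *m T ^+ k.+1 = T ^+ k.+1.
  by rewrite -(mulmxA T) -(mulmxA T) XTk mulmxE -exprS.
rewrite mulmxDl -(mulmxA Z) mulmxBl mul1mx TXTk subrr mulmx0 addr0.
by rewrite -(mulmxA B) -(mulmxA B) XTk.
Qed.

End RankAndSolutions.

Theorem theorem3p36 (R : realType) (m n : nat)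
  (A B : 'M[R[i]]_(m, n)) (B1 W : 'M[R[i]]_(n, m))
  (hAB : (A *m W) *m (B *m W) = (B *m W) *m (A *m W))
  (k : nat)
  (hk : k = maxn (mxind (A *m W))
              (maxn (mxind (B *m W)) (mxind (A *m W *m B *m W))))
  (X2 Y3 Z2 : 'M[R[i]]_(m, n))
  (hX2 : min_rank_weak_drazin W (A *m W *m B) X2)
  (hY3 : min_rank_weak_drazin W B Y3)
  (hZ2 : min_rank_weak_drazin W A Z2)
  (hY3A : (Y3 *m W) *m (A *m W) = (A *m W) *m (Y3 *m W))
  (Y : 'M[R[i]]_(n, m))
  (hY : weak_mpd W (A *m W *m B) Y) :
  (Y *m (A *m W *m B *m W) ^+ k.+1 = B1 *m (A *m W *m B *m W) ^+ k <->
   exists Z : 'M[R[i]]_(n, m),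
     Y = B1 *m X2 *m W + Z *m (1%:M - A *m W *m B *m W *m X2 *m W)) /\
  (forall U : 'M[R[i]]_(n, m),
     U *m (A *m W *m B *m W) ^+ k.+1 = B1 *m (A *m W *m B *m W) ^+ k <->
     exists Z : 'M[R[i]]_(n, m),
       U = B1 *m X2 *m W + Z *m (1%:M - A *m W *m B *m W *m X2 *m W)).
Proof.
have [XWT rX] := hX2.
have le_jk : (mxind (A *m W *m B *m W) <= k)%N.
  rewrite hk; exact: leq_trans (leq_maxr _ _) (leq_maxr _ _).
(* The unknown is left open, so that [sol] serves both for [Y] and for every [U]. *)
have sol := weak_inverse_equation_solutions B1 _ XWT rX le_jk.
split; first exact: sol.
move=> U; exact: sol.
Qed.
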